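(* Let $q\in(0,1)$, $j\in\{\tfrac12,1,\tfrac32,\dots\}$, $L\ge2$. Let $H_{(L)}$ be the quantum Hamiltonian and $G_{(L)}$ the diagonal ground-state matrix, both on $(\mathbb C^{2j+1})^{\otimes L}$, defined in the context. Then the action of $\mathcal L^{(L)}:=G_{(L)}^{-1}H_{(L)}G_{(L)}$ on functions $f:\{0,\dots,2j\}^L\to\mathbb R$ (viewed as column vectors) is $$(\mathcal L^{(L)}f)(\eta)=\sum_{i=1}^{L-1}\Big\{q^{\eta_i-\eta_{i+1}-(2j+1)}[\eta_i]_q[2j-\eta_{i+1}]_q\,(f(\eta^{i,i+1})-f(\eta))+q^{\eta_i-\eta_{i+1}+(2j+1)}[2j-\eta_i]_q[\eta_{i+1}]_q\,(f(\eta^{i+1,i})-f(\eta))\Big\},$$ where $\eta^{i,k}$ is obtained from $\eta$ by moving one particle from site $i$ to site $k$; i.e. $\mathcal L^{(L)}$ is the generator of the ASEP$(q,j)$ on $\{1,\dots,L\}$ with closed boundary conditions.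
   Context: $[x]_q=\frac{q^x-q^{-x}}{q-q^{-1}}$, $[n]_q!=[n]_q\cdots[1]_q$ (with $[0]_q!=1$), $\binom nk_q=\frac{[n]_q!}{[k]_q![n-k]_q!}$. On $\mathbb C^{2j+1}$ with orthonormal basis $|n\rangle$, $n=0,\dots,2j$, let $J^+|n\rangle=\sqrt{[2j-n]_q[n+1]_q}\,|n+1\rangle$, $J^-|n\rangle=\sqrt{[n]_q[2j-n+1]_q}\,|n-1\rangle$, $J^0|n\rangle=(n-j)|n\rangle$. On $(\mathbb C^{2j+1})^{\otimes L}$ with basis $|\eta\rangle=|\eta_1,\dots,\eta_L\rangle=|\eta_1\rangle\otimes\cdots\otimes|\eta_L\rangle$, let $J_i^{\pm},J_i^0$ act on the $i$-th factor. For neighbouring sites put $\Delta(J_i^\pm)=J_i^\pm q^{-J_{i+1}^0}+q^{J_i^0}J_{i+1}^\pm$, $\Delta(J_i^0)=J_i^0+J_{i+1}^0$, and, with the Casimir $C=J^-J^++[J^0]_q[J^0+1]_q$, $$\Delta(C_i)=\Delta(J_i^-)\Delta(J_i^+)+[\Delta(J_i^0)]_q[\Delta(J_i^0)+1]_q .$$ The quantum Hamiltonian is $$H_{(L)}=\sum_{i=1}^{L-1}\big(\Delta(C_i)-[2j]_q[2j+1]_q\big).$$ $G_{(L)}$ is the diagonal matrix with entries $$\langle\eta|G_{(L)}|\eta\rangle=\prod_{i=1}^L\sqrt{\binom{2j}{\eta_i}_q}\;q^{\eta_i(1+j-2ji)} .$$ *)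

(* Defs.v *)
From HB Require Import structures.
From mathcomp Require Import all_boot all_order all_algebra.
From mathcomp Require Import all_classical all_reals all_analysis.
From mathcomp Require Export complex.

Set Implicit Arguments.
Unset Strict Implicit.
Unset Printing Implicit Defensive.

Import Order.TTheory GRing.Theory Num.Theory.
Local Open Scope ring_scope.
Local Open Scope complex_scope.

(* Throughout, [d : nat] stands for [2j]; the half-integer [j] is [spin R d]. *)
Definition spin (R : realType) (d : nat) : R := d%:R / 2.

Section QNumbers.
Variables (R : realType) (q : R).

Definition qnum (x : R) : R := (q `^ x - q `^ (- x)) / (q - q^-1).

Definition qfact (n : nat) : R := \prod_(1 <= k < n.+1) qnum k%:R.

Definition qbinom (n k : nat) : R := qfact n / (qfact k * qfact (n - k)).

(* The principal power [q^z = exp (z ln q)] of the positive real [q]. *)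
Definition cpow (z : R[i]) : R[i] :=
  (q `^ (complex.Re z))%:C *
  (cos (complex.Im z * ln q) +i* sin (complex.Im z * ln q)).

(* [q^A] for an operator [A] that is diagonal in the distinguished basis, the
   only case that occurs: [A] is always built from the operators [J^0]. *)
Definition qpowmx n (A : 'M[R[i]]_n) : 'M[R[i]]_n :=
  diag_mx (\row_a cpow (A a a)).

Definition qnummx n (A : 'M[R[i]]_n) : 'M[R[i]]_n :=
  ((q - q^-1)^-1)%:C *: (qpowmx A - qpowmx (- A)).

End QNumbers.

Section SingleSite.
Variables (R : realType) (q : R) (d : nat).

(* Matrices act on column vectors: the entry [(m, n)] is [<m| A |n>]. *)
Definition Jplus : 'M[R[i]]_d.+1 := \matrix_(m, n)
  if m == n.+1 :> nat
  then (Num.sqrt (qnum q (d%:R - n%:R) * qnum q (n%:R + 1)))%:C else 0.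

Definition Jminus : 'M[R[i]]_d.+1 := \matrix_(m, n)
  if m.+1 == n :> nat
  then (Num.sqrt (qnum q n%:R * qnum q (d%:R - n%:R + 1)))%:C else 0.

Definition Jzero : 'M[R[i]]_d.+1 :=
  diag_mx (\row_n (n%:R - spin R d)%:C).

End SingleSite.

(* The sites [1, ..., L] are the ordinals [0, ..., L - 1]: [i : 'I_L] is the
   site number [i.+1]. *)
Definition config (d L : nat) := {ffun 'I_L -> 'I_d.+1}.

Definition conf_dim (d L : nat) : nat := #|{: config d L}|.

(* The bond [i : 'I_L.-1] joins the sites [lsite i] and [rsite i]. *)
Definition lsite (L : nat) (i : 'I_L.-1) : 'I_L := widen_ord (leq_pred L) i.

Lemma rsite_subproof (L : nat) (i : 'I_L.-1) : (i.+1 < L)%N.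
Proof. by case: L i => [|L] [i Hi]. Qed.

Definition rsite (L : nat) (i : 'I_L.-1) : 'I_L := Ordinal (rsite_subproof i).

(* Where the move is impossible, [move i k eta] is conventionally [eta]; the
   corresponding jump rate vanishes there. *)
Definition move (d L : nat) (i k : 'I_L) (eta : config d L) : config d L :=
  if (0 < eta i)%N && (eta k < d)%N then
    [ffun l => if l == i then inord (eta i).-1
               else if l == k then inord (eta k).+1 else eta l]
  else eta.

Section Chain.
Variables (R : realType) (q : R) (d L : nat).

(* Operators on the [L]-fold tensor power of [C^(d+1)], written in the product
   basis [|eta>], with [eta] enumerated by [enum_val] / [enum_rank]. *)
Definition op := 'M[R[i]]_(conf_dim d L).

Definition tensor (A : 'I_L -> 'M[R[i]]_d.+1) : op := \matrix_(a, b)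
  \prod_(l < L) A l ((enum_val a : config d L) l) ((enum_val b : config d L) l).

Definition on_site (i : 'I_L) (A : 'M[R[i]]_d.+1) : op :=
  tensor (fun l => if l == i then A else 1%:M).

Definition DeltaJ (i : 'I_L.-1) (J : 'M[R[i]]_d.+1) : op :=
  on_site (lsite i) J *m qpowmx q (- on_site (rsite i) (Jzero R d)) +
  qpowmx q (on_site (lsite i) (Jzero R d)) *m on_site (rsite i) J.

Definition DeltaJplus (i : 'I_L.-1) : op := DeltaJ i (Jplus q d).

Definition DeltaJminus (i : 'I_L.-1) : op := DeltaJ i (Jminus q d).

Definition DeltaJzero (i : 'I_L.-1) : op :=
  on_site (lsite i) (Jzero R d) + on_site (rsite i) (Jzero R d).

Definition DeltaC (i : 'I_L.-1) : op :=
  DeltaJminus i *m DeltaJplus i +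
  qnummx q (DeltaJzero i) *m qnummx q (DeltaJzero i + 1%:M).

Definition hamiltonian : op :=
  \sum_(i < L.-1) (DeltaC i - (qnum q d%:R * qnum q (d%:R + 1))%:C%:M).

Definition ground_entry (eta : config d L) : R :=
  \prod_(i < L) (Num.sqrt (qbinom q d (eta i)) *
    q `^ ((eta i)%:R * (1 + spin R d - 2 * spin R d * i.+1%:R))).

Definition ground_mx : op :=
  diag_mx (\row_a (ground_entry (enum_val a))%:C).

Definition Lop : op := invmx ground_mx *m hamiltonian *m ground_mx.

Definition op_act (A : op) (f : config d L -> R) (eta : config d L) : R[i] :=
  (A *m \col_a (f (enum_val a))%:C) (enum_rank eta) ord0.

Definition asep_generator (f : config d L -> R) (eta : config d L) : R :=
  \sum_(i < L.-1)
    let x := lsite i in let y := rsite i in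
    (q `^ ((eta x)%:R - (eta y)%:R - (d%:R + 1)) *
       qnum q (eta x)%:R * qnum q (d%:R - (eta y)%:R) *
       (f (move x y eta) - f eta) +
     q `^ ((eta x)%:R - (eta y)%:R + (d%:R + 1)) *
       qnum q (d%:R - (eta x)%:R) * qnum q (eta y)%:R *
       (f (move y x eta) - f eta)).

End Chain.

(* Main.v *)
Require Import Defs.
From mathcomp Require Import all_boot all_order all_algebra.
From mathcomp Require Import all_classical all_reals all_analysis.
From mathcomp Require Import ring.
Import Order.TTheory GRing.Theory Num.Theory.
Local Open Scope ring_scope.
Local Open Scope complex_scope.

(* Conjugation by the ground state removes the square roots from the ladder
   operators: since [n+1] binom(2j, n+1) = [2j-n] binom(2j, n), the operator
   G^-1 J_i^+ G is [eta_i] q^(-e_i) times lowering of the argument at i, and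
   G^-1 J_i^- G is [2j-eta_i] q^(e_i) times raising it, with e_i = 1+j-2ji.
   Expanding the conjugate of Delta(J^-) Delta(J^+), the off-diagonal terms are
   the ASEP jumps because e_(i+1) = e_i - 2j, and the diagonal terms combine with
   the remaining part of the Casimir to minus the total jump rate of the bond. *)

(** * Arithmetic of q-numbers and q-binomials *)

Section QNumberTheory.
Context {R : realType} {q : R}.
Hypotheses (q_gt0 : 0 < q) (q_lt1 : q < 1).

Lemma subr_inv_neq0 : q - q^-1 != 0.
Proof.
rewrite subr_eq0 lt_eqF// (lt_trans q_lt1)//.
by rewrite invf_gt1.
Qed.

Lemma powRDq (x y : R) : q `^ (x + y) = q `^ x * q `^ y.
Proof. by rewrite powRD// (gt_eqF q_gt0) implybT. Qed.

Lemma qnum0 : qnum q 0 = 0.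
Proof. by rewrite /qnum oppr0 subrr mul0r. Qed.

(** Powers of [q < 1] decrease, so numerator and denominator are both negative. This positivity
    legitimises the square roots below. *)
Lemma qnum_gt0 (x : R) : 0 < x -> 0 < qnum q x.
Proof.
move=> x0; have lnq : ln q < 0 by rewrite ln_lt0// q_gt0.
have qV : q < q^-1 by rewrite (lt_trans q_lt1)// invf_gt1.
rewrite /qnum nmulr_lgt0 ?invr_lt0 ?subr_lt0//.
rewrite /powR (gt_eqF q_gt0) ltr_expR.
by rewrite ltr_nM2r// gtrN.
Qed.

Lemma qnum_ge0 (x : R) : 0 <= x -> 0 <= qnum q x.
Proof.
by rewrite le_eqVlt => /predU1P[<-|/qnum_gt0/ltW//]; rewrite qnum0.
Qed.

Lemma qfactS (n : nat) : qfact q n.+1 = qfact q n * qnum q n.+1%:R.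
Proof. by rewrite /qfact big_nat_recr. Qed.

Lemma qfact_gt0 (n : nat) : 0 < qfact q n.
Proof.
elim: n => [|n IHn]; first by rewrite /qfact big_nil.
by rewrite qfactS mulr_gt0// qnum_gt0.
Qed.

Lemma qbinom_gt0 (n k : nat) : 0 < qbinom q n k.
Proof. by rewrite divr_gt0 ?mulr_gt0 ?qfact_gt0. Qed.

Lemma qbinomS (d n : nat) : (n < d)%N ->
  qnum q n.+1%:R * qbinom q d n.+1 = qnum q (d%:R - n%:R) * qbinom q d n.
Proof.
move=> nd; rewrite -natrB; last exact: ltnW.
rewrite /qbinom qfactS -(subnSK nd) qfactS.
have := qfact_gt0 n; have := qfact_gt0 (d - n.+1).
have := qnum_gt0 _ (ltr0Sn R n); have := qnum_gt0 _ (ltr0Sn R (d - n.+1)).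
move=> /lt0r_neq0 ? /lt0r_neq0 ? /lt0r_neq0 ? /lt0r_neq0 ?.
by field; do !(apply/andP; split).
Qed.

(** By [qbinomS] the product under the joint root is [[n+1]^2 binom(d, n+1)], so the root of the
    ladder coefficient disappears. *)
Lemma sqrt_qbinom_lower (d n : nat) : (n < d)%N ->
  Num.sqrt (qnum q (d%:R - n%:R) * qnum q n.+1%:R) * Num.sqrt (qbinom q d n)
  = qnum q n.+1%:R * Num.sqrt (qbinom q d n.+1).
Proof.
move=> nd; have nS0 := qnum_ge0 _ (ler0n R n.+1).
rewrite -sqrtrM; last by rewrite mulr_ge0// qnum_ge0// subr_ge0 ler_nat ltnW.
by rewrite mulrAC -qbinomS// mulrAC -expr2 sqrtrM ?sqr_ge0// sqrtr_sqr ger0_norm.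
Qed.

Lemma sqrt_qbinom_raise (d n : nat) : (n < d)%N ->
  Num.sqrt (qnum q n.+1%:R * qnum q (d%:R - n%:R)) *
    Num.sqrt (qbinom q d n.+1)
  = qnum q (d%:R - n%:R) * Num.sqrt (qbinom q d n).
Proof.
move=> nd; have dn0 : 0 <= qnum q (d%:R - n%:R).
  by rewrite qnum_ge0// subr_ge0 ler_nat ltnW.
rewrite -sqrtrM; last by rewrite mulr_ge0// qnum_ge0.
by rewrite mulrAC qbinomS// mulrAC -expr2 sqrtrM ?sqr_ge0// sqrtr_sqr ger0_norm.
Qed.

Lemma cpow_real (x : R) : cpow q x%:C = (q `^ x)%:C.
Proof. by rewrite /cpow /= mul0r cos0 sin0 mulr1. Qed.

(** Conservation of probability on one bond: the diagonal of the conjugated bond term is minus the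
    total jump rate. Once the powers are split, it is a rational identity in [q], [q^a], [q^b] and
    [q^d]. *)
Lemma bond_diagonal (a b d : R) :
  qnum q (d - a) * qnum q (a + 1) * q `^ (d - 2 * b) +
  q `^ (2 * a - d) * qnum q (d - b) * qnum q (b + 1) +
  qnum q (a + b - d) * qnum q (a + b - d + 1) - qnum q d * qnum q (d + 1) =
  - (q `^ (a - b - (d + 1)) * qnum q a * qnum q (d - b)) -
  q `^ (a - b + (d + 1)) * qnum q (d - a) * qnum q b.
Proof.
have qn0 : q != 0 by rewrite gt_eqF.
have d0 := subr_inv_neq0.
have two (x : R) : q `^ (2 * x) = q `^ x ^+ 2 by rewrite mulr_natl mulr2n powRDq.
have pn0 (x : R) : q `^ x != 0 by rewrite gt_eqF// powR_gt0.
have q2n0 : q ^+ 2 - 1 != 0.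
  have -> : q ^+ 2 - 1 = q * (q - q^-1) by field.
  by rewrite mulf_neq0.
rewrite /qnum !(opprD, opprK) !(powRDq, powRN, two, powRr1 (ltW q_gt0)).
by field; rewrite ?qn0 ?pn0 ?q2n0.
Qed.

End QNumberTheory.

(** * Changing a configuration at one site *)

Definition upd {d L : nat} (eta : config d L) (i : 'I_L) (m : 'I_d.+1) :
    config d L :=
  [ffun l => if l == i then m else eta l].

Lemma upd_same {d L : nat} (eta : config d L) i m : upd eta i m i = m.
Proof. by rewrite ffunE eqxx. Qed.

Lemma upd_neq {d L : nat} (eta : config d L) i k m :
  k != i -> upd eta i m k = eta k.
Proof. by rewrite ffunE => /negPf->. Qed.

Lemma upd_id {d L : nat} (eta : config d L) i : upd eta i (eta i) = eta.
Proof. by apply/ffunP => l; rewrite ffunE; case: eqP => // ->. Qed.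

Lemma upd_upd {d L : nat} (eta : config d L) i m n :
  upd (upd eta i m) i n = upd eta i n.
Proof. by apply/ffunP => l; rewrite !ffunE; case: eqP. Qed.

Lemma updC {d L : nat} (eta : config d L) i k m n : i != k ->
  upd (upd eta i m) k n = upd (upd eta k n) i m.
Proof.
move=> ik; apply/ffunP => l; rewrite !ffunE.
by case: (eqVneq l k) => // ->; rewrite eq_sym (negPf ik).
Qed.

Lemma move_upd {d L : nat} (eta : config d L) i k : i != k ->
    (0 < eta i)%N -> (eta k < d)%N ->
  move i k eta = upd (upd eta i (inord (eta i).-1)) k (inord (eta k).+1).
Proof.
move=> ik i0 kd; rewrite /move i0 kd /=; apply/ffunP => l; rewrite !ffunE.
by case: (eqVneq l i) => // ->; rewrite (negPf ik).
Qed.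

(** * Matrices as operators on functions of configurations *)

Section Representation.
Set Implicit Arguments.
Context {R : realType} {d L : nat}.
Implicit Types (A B : op R d L) (f : config d L -> R) (eta : config d L).

(** Although entries are complex, every operator needed here preserves real functions. Tracking its
    real action [T] replaces matrix products by composition. *)
Definition represents A (T : (config d L -> R) -> config d L -> R) : Prop :=
  forall f eta, op_act A f eta = (T f eta)%:C.

Lemma represents_eq A T T' :
  represents A T -> (forall f eta, T f eta = T' f eta) -> represents A T'.
Proof. by move=> AT TT f eta; rewrite AT TT. Qed.

Lemma represents_mul A B T S : represents A T -> represents B S ->
  represents (A *m B) (fun f => T (S f)).
Proof.
move=> AT BS f eta; rewrite -AT /op_act -mulmxA; congr ((_ *m _) _ _).
apply/colP => a; have := BS f (enum_val a); rewrite /op_act enum_valK => ->.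
by rewrite mxE.
Qed.

Lemma represents_add A B T S : represents A T -> represents B S ->
  represents (A + B) (fun f eta => T f eta + S f eta).
Proof.
by move=> AT BS f eta; rewrite rmorphD /= -AT -BS /op_act mulmxDl mxE.
Qed.

Lemma represents_opp A T : represents A T ->
  represents (- A) (fun f eta => - T f eta).
Proof. by move=> AT f eta; rewrite rmorphN /= -AT /op_act mulNmx mxE. Qed.

Lemma represents_sum (I : finType) (A : I -> op R d L) T :
  (forall i, represents (A i) (T i)) ->
  represents (\sum_i A i) (fun f eta => \sum_i T i f eta).
Proof.
move=> AT f eta; rewrite rmorph_sum /= /op_act mulmx_suml summxE.
by apply: eq_bigr => i _; rewrite -AT.
Qed.

Lemma represents_diag (r : 'rV[R[i]]_(conf_dim d L)) (h : config d L -> R) :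
  (forall eta, r ord0 (enum_rank eta) = (h eta)%:C) ->
  represents (diag_mx r) (fun f eta => h eta * f eta).
Proof.
move=> rh f eta.
by rewrite /op_act mul_diag_mx !mxE rh enum_rankK rmorphM.
Qed.

Lemma represents_scalar (c : R) :
  represents (c%:C%:M) (fun f eta => c * f eta).
Proof.
by rewrite -diag_const_mx; apply: represents_diag => eta; rewrite mxE.
Qed.

(** [qpowmx] reads only the diagonal of its argument, so the values [h] determine the operator. *)
Lemma represents_qpow (q : R) A (h : config d L -> R) :
  (forall eta, A (enum_rank eta) (enum_rank eta) = (h eta)%:C) ->
  represents (qpowmx q A) (fun f eta => q `^ h eta * f eta).
Proof.
by move=> Ah; apply: represents_diag => eta; rewrite mxE Ah cpow_real.
Qed.

Lemma represents_qnum (q : R) A (h : config d L -> R) :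
  (forall eta, A (enum_rank eta) (enum_rank eta) = (h eta)%:C) ->
  represents (qnummx q A) (fun f eta => qnum q (h eta) * f eta).
Proof.
move=> Ah; rewrite /qnummx -mul_scalar_mx.
apply: represents_eq.
  apply: (represents_mul (represents_scalar _)).
  apply: represents_add; first exact: represents_qpow Ah.
  apply/represents_opp/(@represents_qpow _ _ (fun eta => - h eta)) => eta.
  by rewrite mxE Ah rmorphN.
by move=> f eta; rewrite /qnum -mulrBl mulrCA mulrA.
Qed.

(** The identity factors away from [i] force [eta] and [zeta] to agree there; the equation with
    [upd] records exactly this. *)
Lemma on_siteE i (M : 'M[R[i]]_d.+1) eta zeta :
  on_site i M (enum_rank eta) (enum_rank zeta) =
  M (eta i) (zeta i) *+ (zeta == upd eta i (zeta i)).
Proof.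
rewrite /on_site /tensor mxE !enum_rankK (bigD1 i)//= eqxx.
case: eqP => [->|ne].
  rewrite big1 ?mulr1// => l /negPf li.
  by rewrite li mxE upd_neq ?li// eqxx.
rewrite mulr0n; apply/eqP; rewrite mulf_eq0; apply/orP; right.
(* A disagreement away from [i] contributes an off-diagonal entry of an identity matrix, which kills
   the product. *)
case: (pickP (fun l => (l != i) && (eta l != zeta l))) => [l /andP[li el]|all_eq].
  by rewrite (bigD1 l)//= (negPf li) mxE (negPf el) mul0r.
case: ne; apply/ffunP => l; rewrite ffunE; case: eqVneq => [->//|li].
by have /negbT := all_eq l; rewrite li negbK => /eqP.
Qed.

(** Row [m] of [M] has at most one non-zero entry, in column [s m], so the sum over configurations
    collapses to one term. *)
Lemma represents_on_site i (M : 'M[R[i]]_d.+1) (c : 'I_d.+1 -> R) s :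
  (forall m n, M m n = (c m)%:C *+ (n == s m)) ->
  represents (on_site i M) (fun f eta => c (eta i) * f (upd eta i (s (eta i)))).
Proof.
move=> Mcs f eta; rewrite /op_act mxE.
rewrite (reindex_onto enum_rank enum_val) => [|a _]; last exact: enum_valK.
rewrite (bigD1 (upd eta i (s (eta i)))) ?enum_rankK//= big1 => [|zeta].
  by rewrite on_siteE Mcs upd_same !eqxx mxE enum_rankK addr0 rmorphM.
rewrite enum_rankK eqxx => /= ne; rewrite on_siteE Mcs.
case: eqP => [zs|_]; last by rewrite mulr0n mul0rn mul0r.
case: eqP => [ez|_]; last by rewrite mulr0n mul0r.
by rewrite ez zs eqxx in ne.
Qed.

Lemma on_site_Jzero i eta :
  on_site i (Jzero R d) (enum_rank eta) (enum_rank eta) =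
  ((eta i)%:R - spin R d)%:C.
Proof. by rewrite on_siteE upd_id eqxx /Jzero !mxE eqxx. Qed.

End Representation.

(** * Ladder operators, their coproducts and the Casimir on functions *)

Section Chain.
Set Implicit Arguments.
Context {R : realType} {q : R} {d L : nat}.
Hypotheses (q_gt0 : 0 < q) (q_lt1 : q < 1).
Implicit Types (f : config d L -> R) (eta : config d L).

Local Notation j := (spin R d).
Local Notation G := (@ground_entry R q d L).

Definition lower eta (i : 'I_L) : config d L := upd eta i (inord (eta i).-1).

(** At a full site [inord] falls back to [0]; [raise_coef] vanishes there. *)
Definition raise eta (i : 'I_L) : config d L := upd eta i (inord (eta i).+1).

Definition lower_coef (n : nat) : R :=
  Num.sqrt (qnum q (d%:R - n.-1%:R) * qnum q n%:R).

Definition raise_coef (n : nat) : R :=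
  Num.sqrt (qnum q n.+1%:R * qnum q (d%:R - n%:R)).

(** Row [m] of [Jplus] is supported on column [m - 1]: on column vectors [J^+] evaluates the
    function at a lowered argument. *)
Lemma represents_Jplus i :
  represents (on_site i (Jplus q d))
    (fun f eta => lower_coef (eta i) * f (lower eta i)).
Proof.
apply: (@represents_on_site _ _ _ _ _ (fun m : 'I_d.+1 => lower_coef m)
  (fun m => inord m.-1)) => m n; rewrite mxE.
have mv : (inord m.-1 : 'I_d.+1) = m.-1 :> nat.
  by rewrite inordK// ltnS (leq_trans (leq_pred m))// -ltnS.
rewrite -val_eqE /= mv /lower_coef.
case: eqP => [->|]; first by rewrite eqxx natr1.
(* Row [0] is zero, and the truncated predecessor is harmless because the coefficient contains [[0]
   = 0]. *)
case: (m : nat) => [|k] mn; first by rewrite qnum0 mulr0 sqrtr0 mul0rn.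
by case: eqP => // nk; case: mn; rewrite nk.
Qed.

Lemma represents_Jminus i :
  represents (on_site i (Jminus q d))
    (fun f eta => raise_coef (eta i) * f (raise eta i)).
Proof.
apply: (@represents_on_site _ _ _ _ _ (fun m : 'I_d.+1 => raise_coef m)
  (fun m => inord m.+1)) => m n; rewrite mxE /raise_coef.
have := ltn_ord m; rewrite ltnS leq_eqVlt => /predU1P[md|md].
  (* In row [d] the coefficient contains [[d - d] = 0], and no column has index [d + 1]. *)
  rewrite md subrr qnum0 mulr0 sqrtr0 mul0rn.
  by case: eqP => // dn; have := ltn_ord n; rewrite -dn ltnn.
rewrite -val_eqE /= inordK// eq_sym; case: eqP => // ->.
by congr ((Num.sqrt (_ * qnum q _))%:C); rewrite -natr1; ring.
Qed.

Section Bond.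
Variable i : 'I_L.-1.
Let x := lsite i.
Let y := rsite i.

Definition lower_bond f eta : R :=
  lower_coef (eta x) * (q `^ (j - (eta y)%:R) * f (lower eta x)) +
  q `^ ((eta x)%:R - j) * (lower_coef (eta y) * f (lower eta y)).

Definition raise_bond f eta : R :=
  raise_coef (eta x) * (q `^ (j - (eta y)%:R) * f (raise eta x)) +
  q `^ ((eta x)%:R - j) * (raise_coef (eta y) * f (raise eta y)).

Lemma sites_neq : x != y.
Proof. by rewrite -val_eqE /= neq_ltn ltnSn. Qed.

(** In the first product the power of [q] is evaluated after the change at [x]; since [s] alters one
    site only, its exponent at [y] is still that of [eta]. *)
Lemma represents_DeltaJ (J : 'M[R[i]]_d.+1) (c : nat -> R)
    (s : config d L -> 'I_L -> config d L) :
  (forall k, represents (on_site k J) (fun f eta => c (eta k) * f (s eta k))) ->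
  (forall eta k l, l != k -> s eta k l = eta l) ->
  represents (DeltaJ q i J) (fun f eta =>
    c (eta x) * (q `^ (j - (eta y)%:R) * f (s eta x)) +
    q `^ ((eta x)%:R - j) * (c (eta y) * f (s eta y))).
Proof.
move=> Js s_neq; apply: represents_eq.
  apply: represents_add; apply: represents_mul; [exact: Js| | |exact: Js].
    apply: (@represents_qpow _ _ _ _ _ (fun eta => j - (eta y)%:R)) => eta.
    by rewrite mxE on_site_Jzero -rmorphN opprB.
  apply: (@represents_qpow _ _ _ _ _ (fun eta => (eta x)%:R - j)) => eta.
  by rewrite on_site_Jzero.
by move=> f eta /=; rewrite s_neq// eq_sym sites_neq.
Qed.

Lemma represents_DeltaJplus : represents (DeltaJplus q d i) lower_bond.
Proof.
apply: represents_DeltaJ; first exact: represents_Jplus.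
by move=> eta k l lk; rewrite upd_neq.
Qed.

Lemma represents_DeltaJminus : represents (DeltaJminus q d i) raise_bond.
Proof.
apply: represents_DeltaJ; first exact: represents_Jminus.
by move=> eta k l lk; rewrite upd_neq.
Qed.

(** Since [2j = d], the eigenvalue of [Delta(J^0)] on [eta] is [eta x + eta y - d]. *)
Definition bond_hamiltonian f eta : R :=
  raise_bond (lower_bond f) eta +
  (qnum q ((eta x)%:R + (eta y)%:R - d%:R) *
   qnum q ((eta x)%:R + (eta y)%:R - d%:R + 1) -
   qnum q d%:R * qnum q (d%:R + 1)) * f eta.

Lemma double_spin : j + j = d%:R.
Proof. by rewrite /spin; field. Qed.

Lemma represents_bond_hamiltonian :
  represents (DeltaC q d i - (qnum q d%:R * qnum q (d%:R + 1))%:C%:M)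
    bond_hamiltonian.
Proof.
have dJ eta : DeltaJzero R d i (enum_rank eta) (enum_rank eta) =
    ((eta x)%:R + (eta y)%:R - d%:R : R)%:C.
  rewrite mxE !on_site_Jzero -rmorphD /=; congr (_%:C).
  by rewrite -double_spin; ring.
apply: represents_eq.
  apply: represents_add; last exact/represents_opp/represents_scalar.
  apply: represents_add.
    exact: represents_mul represents_DeltaJminus represents_DeltaJplus.
  apply: represents_mul; first exact: represents_qnum dJ.
  apply: (@represents_qnum _ _ _ _ _
    (fun eta => (eta x)%:R + (eta y)%:R - d%:R + 1)) => eta.
  by rewrite mxE dJ mxE eqxx -rmorphD.
by move=> f eta; rewrite /bond_hamiltonian; ring.
Qed.

End Bond.

(** * Ground-state conjugation of the ladder operators *)

Definition site_exponent (i : 'I_L) : R := 1 + j - 2 * j * i.+1%:R.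

Definition site_weight (i : 'I_L) (n : nat) : R :=
  Num.sqrt (qbinom q d n) * q `^ (n%:R * site_exponent i).

Lemma site_weight_neq0 i n : site_weight i n != 0.
Proof.
by rewrite mulf_neq0// gt_eqF ?powR_gt0// sqrtr_gt0 qbinom_gt0.
Qed.

Lemma ground_entry_neq0 eta : G eta != 0.
Proof.
by apply/prodf_neq0 => i _; exact: site_weight_neq0.
Qed.

(** [G] is a product over sites and only its factor at [i] changes. The cross-multiplied form avoids
    division. *)
Lemma ground_entry_upd eta i m :
  site_weight i (eta i) * G (upd eta i m) = site_weight i m * G eta.
Proof.
rewrite /ground_entry (bigD1 i)//= [in RHS](bigD1 i)//= upd_same mulrCA.
congr (_ * (_ * _)); apply: eq_bigr => l li.
by rewrite upd_neq.
Qed.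

(** Cancelling [G eta] leaves a one-site identity: [sqrt_qbinom_lower] removes the root, and losing
    one particle contributes [q^(-e_i)]. *)
Lemma lower_coef_ground_entry eta i :
  lower_coef (eta i) * G (lower eta i) =
  qnum q (eta i)%:R * q `^ (- site_exponent i) * G eta.
Proof.
apply: (mulfI (site_weight_neq0 i (eta i))).
rewrite mulrCA ground_entry_upd mulrA [RHS]mulrA; congr (_ * _).
have := ltn_ord (eta i); rewrite /lower_coef.
(* At an empty site both sides vanish through [[0]]. *)
case: (eta i : nat) => [|n] nd; first by rewrite qnum0 mulr0 sqrtr0 !mul0r mulr0.
rewrite inordK ?(ltnW nd)// /site_weight mulrA sqrt_qbinom_lower//.
have -> : n%:R * site_exponent i = n.+1%:R * site_exponent i - site_exponent i.
  by rewrite -natr1; ring.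
by rewrite powRDq//; ring.
Qed.

Lemma raise_coef_ground_entry eta i :
  raise_coef (eta i) * G (raise eta i) =
  qnum q (d%:R - (eta i)%:R) * q `^ site_exponent i * G eta.
Proof.
apply: (mulfI (site_weight_neq0 i (eta i))).
rewrite mulrCA ground_entry_upd mulrA [RHS]mulrA; congr (_ * _).
have := ltn_ord (eta i); rewrite ltnS leq_eqVlt /raise_coef => /predU1P[->|nd].
  by rewrite subrr qnum0 mulr0 sqrtr0 !mul0r mulr0.
rewrite inordK// /site_weight mulrA sqrt_qbinom_raise//.
have -> : (eta i).+1%:R * site_exponent i =
    (eta i)%:R * site_exponent i + site_exponent i.
  by rewrite -natr1; ring.
by rewrite powRDq//; ring.
Qed.

(** * The conjugated bond term and the ASEP rates *)

Section ConjugatedBond.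
Variable i : 'I_L.-1.
Let x := lsite i.
Let y := rsite i.

Definition lower_conj f eta : R :=
  qnum q (eta x)%:R * q `^ (j - (eta y)%:R - site_exponent x) *
    f (lower eta x) +
  qnum q (eta y)%:R * q `^ ((eta x)%:R - j - site_exponent y) *
    f (lower eta y).

Definition raise_conj f eta : R :=
  qnum q (d%:R - (eta x)%:R) * q `^ (j - (eta y)%:R + site_exponent x) *
    f (raise eta x) +
  qnum q (d%:R - (eta y)%:R) * q `^ ((eta x)%:R - j + site_exponent y) *
    f (raise eta y).

(** An equality of functions, so that it can be rewritten inside [raise_bond]; keeping [G] outside
    lets the next conjugation apply to the result. *)
Lemma lower_bond_ground f :
  lower_bond i (fun z => G z * f z) = fun z => G z * lower_conj f z.
Proof.
apply/funext => eta; rewrite /lower_bond /lower_conj -/x -/y.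
transitivity (q `^ (j - (eta y)%:R) *
    (lower_coef (eta x) * G (lower eta x)) * f (lower eta x) +
  q `^ ((eta x)%:R - j) *
    (lower_coef (eta y) * G (lower eta y)) * f (lower eta y)); first by ring.
by rewrite !lower_coef_ground_entry !powRDq//; ring.
Qed.

Lemma raise_bond_ground f :
  raise_bond i (fun z => G z * f z) = fun z => G z * raise_conj f z.
Proof.
apply/funext => eta; rewrite /raise_bond /raise_conj -/x -/y.
transitivity (q `^ (j - (eta y)%:R) *
    (raise_coef (eta x) * G (raise eta x)) * f (raise eta x) +
  q `^ ((eta x)%:R - j) *
    (raise_coef (eta y) * G (raise eta y)) * f (raise eta y)); first by ring.
by rewrite !raise_coef_ground_entry !powRDq//; ring.
Qed.

Lemma site_exponent_succ : site_exponent y = site_exponent x - d%:R.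
Proof. by rewrite /site_exponent /= -double_spin -[i.+2%:R]natr1; ring. Qed.

Lemma lower_raise eta k : (eta k < d)%N -> lower (raise eta k) k = eta.
Proof.
by move=> kd; rewrite /lower /raise upd_upd upd_same inordK//= inord_val upd_id.
Qed.

(** When the jump is possible, raising [y] and lowering [x] is the move. Otherwise the two
    configurations may differ, but a q-number in the rate is zero, which is why the rate stays as a
    factor. *)
Lemma hop_right eta f :
  qnum q (eta x)%:R * qnum q (d%:R - (eta y)%:R) * f (lower (raise eta y) x) =
  qnum q (eta x)%:R * qnum q (d%:R - (eta y)%:R) * f (move x y eta).
Proof.
have [->|x0] := posnP (eta x); first by rewrite qnum0 !mul0r.
have := ltn_ord (eta y); rewrite ltnS leq_eqVlt => /predU1P[->|yd].
  by rewrite subrr qnum0 mulr0 !mul0r.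
rewrite move_upd ?sites_neq// /lower /raise upd_neq ?sites_neq//.
by rewrite updC// eq_sym sites_neq.
Qed.

Lemma hop_left eta f :
  qnum q (d%:R - (eta x)%:R) * qnum q (eta y)%:R * f (lower (raise eta x) y) =
  qnum q (d%:R - (eta x)%:R) * qnum q (eta y)%:R * f (move y x eta).
Proof.
have yx : y != x by rewrite eq_sym sites_neq.
have [->|y0] := posnP (eta y); first by rewrite qnum0 mulr0 !mul0r.
have := ltn_ord (eta x); rewrite ltnS leq_eqVlt => /predU1P[->|xd].
  by rewrite subrr qnum0 !mul0r.
by rewrite move_upd// /lower /raise upd_neq// updC// sites_neq.
Qed.

(** Of the four terms, raising and lowering the same site returns [eta], and using different sites
    gives the two jumps. *)
Lemma raise_lower_conj f eta :
  raise_conj (lower_conj f) eta =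
  (qnum q (d%:R - (eta x)%:R) * qnum q ((eta x)%:R + 1) *
     q `^ (d%:R - 2 * (eta y)%:R) +
   q `^ (2 * (eta x)%:R - d%:R) *
     qnum q (d%:R - (eta y)%:R) * qnum q ((eta y)%:R + 1)) * f eta +
  q `^ ((eta x)%:R - (eta y)%:R - (d%:R + 1)) *
     (qnum q (eta x)%:R * qnum q (d%:R - (eta y)%:R) * f (move x y eta)) +
  q `^ ((eta x)%:R - (eta y)%:R + (d%:R + 1)) *
     (qnum q (d%:R - (eta x)%:R) * qnum q (eta y)%:R * f (move y x eta)).
Proof.
have xy := sites_neq i; have yx : y != x by rewrite eq_sym.
rewrite -hop_right -hop_left.
(* The prefactor is kept because it vanishes at a full site; elsewhere raising is undone by
   lowering. *)
have at_x : qnum q (d%:R - (eta x)%:R) * lower_conj f (raise eta x) =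
    qnum q (d%:R - (eta x)%:R) *
    (qnum q ((eta x)%:R + 1) * q `^ (j - (eta y)%:R - site_exponent x) * f eta +
     qnum q (eta y)%:R * q `^ ((eta x)%:R + 1 - j - site_exponent y) *
       f (lower (raise eta x) y)).
  have := ltn_ord (eta x); rewrite ltnS leq_eqVlt => /predU1P[->|xd].
    by rewrite subrr qnum0 !mul0r.
  rewrite /lower_conj lower_raise// /raise upd_same inordK// upd_neq//.
  by rewrite natr1.
have at_y : qnum q (d%:R - (eta y)%:R) * lower_conj f (raise eta y) =
    qnum q (d%:R - (eta y)%:R) *
    (qnum q (eta x)%:R * q `^ (j - ((eta y)%:R + 1) - site_exponent x) *
       f (lower (raise eta y) x) +
     qnum q ((eta y)%:R + 1) * q `^ ((eta x)%:R - j - site_exponent y) * f eta).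
  have := ltn_ord (eta y); rewrite ltnS leq_eqVlt => /predU1P[->|yd].
    by rewrite subrr qnum0 !mul0r.
  rewrite /lower_conj lower_raise// /raise upd_same inordK// upd_neq//.
  by rewrite natr1.
rewrite {1}/raise_conj mulrAC at_x [X in _ + X]mulrAC at_y site_exponent_succ.
set a := (eta x)%:R; set b := (eta y)%:R; set e := site_exponent x.
rewrite -double_spin.
(* Each target exponent is written as a raising exponent plus a lowering exponent, in which [e]
   cancels. *)
have -> : j + j - 2 * b = (j - b + e) + (j - b - e) by ring.
have -> : 2 * a - (j + j) = (a - j + (e - (j + j))) + (a - j - (e - (j + j))).
  by ring.
have -> : a - b - (j + j + 1) = (a - j + (e - (j + j))) + (j - (b + 1) - e).
  by ring.
have -> : a - b + (j + j + 1) = (j - b + e) + (a + 1 - j - (e - (j + j))).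
  by ring.
by rewrite !(powRDq q_gt0 (_ + _) (_ - _)); ring.
Qed.

Lemma bond_hamiltonian_ground f eta :
  bond_hamiltonian i (fun z => G z * f z) eta = G eta *
  (q `^ ((eta x)%:R - (eta y)%:R - (d%:R + 1)) *
     qnum q (eta x)%:R * qnum q (d%:R - (eta y)%:R) *
     (f (move x y eta) - f eta) +
   q `^ ((eta x)%:R - (eta y)%:R + (d%:R + 1)) *
     qnum q (d%:R - (eta x)%:R) * qnum q (eta y)%:R *
     (f (move y x eta) - f eta)).
Proof.
rewrite /bond_hamiltonian lower_bond_ground raise_bond_ground raise_lower_conj.
rewrite [X in _ + X]mulrCA -mulrDr -/x -/y; congr (_ * _).
have /eqP := bond_diagonal q_gt0 q_lt1 (eta x)%:R (eta y)%:R d%:R.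
rewrite -subr_eq0 => /eqP diag; apply/eqP; rewrite -subr_eq0; apply/eqP.
(* The jump terms cancel, so the difference of the two sides is the quantity in [diag] times
   [f eta]. *)
by rewrite -[RHS](mul0r (f eta)) -diag; ring.
Qed.

End ConjugatedBond.

(** * The inverse ground state and the full generator *)

Lemma represents_ground :
  represents (ground_mx q d L) (fun f eta => G eta * f eta).
Proof. by apply: represents_diag => eta; rewrite mxE enum_rankK. Qed.

Lemma represents_ground_inv :
  represents (invmx (ground_mx q d L)) (fun f eta => (G eta)^-1 * f eta).
Proof.
set D : op R d L := diag_mx (\row_a ((G (enum_val a))^-1)%:C).
have DG : D *m ground_mx q d L = 1%:M.
  rewrite mulmx_diag -diag_const_mx; congr diag_mx; apply/rowP => a.
  by rewrite !mxE -rmorphM mulVf// ground_entry_neq0.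
(* The left inverse [D] makes the square matrix invertible, hence [invmx] equals [D]. *)
have [_ Gunit] := mulmx1_unit DG.
rewrite -[invmx _]mul1mx -DG -mulmxA mulmxV// mulmx1.
by apply: represents_diag => eta; rewrite mxE enum_rankK.
Qed.

(** The same [G] factors out of every bond term, so its inverse cancels it summand by summand. *)
Lemma represents_Lop : represents (Lop q d L) (@asep_generator R q d L).
Proof.
apply: represents_eq.
  apply: represents_mul represents_ground.
  apply: represents_mul represents_ground_inv _.
  apply: represents_sum => i; exact: represents_bond_hamiltonian.
move=> f eta /=; rewrite mulr_sumr; apply: eq_bigr => i _.
by rewrite bond_hamiltonian_ground mulKf ?ground_entry_neq0.
Qed.

End Chain.

Theorem proposition5p2 (R : realType) (q : R) (d L : nat)
  (q_gt0 : 0 < q) (q_lt1 : q < 1) (d_gt0 : (0 < d)%N) (L_ge2 : (2 <= L)%N)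
  (f : config d L -> R) (eta : config d L) :
  op_act (Lop q d L) f eta = (asep_generator q f eta)%:C.
Proof. exact: represents_Lop. Qed.
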